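(* Let $G$ be a co-bipartite graph. Then $G$ is a circle graph if and only if $G$ is a permutation graph.
   Context: All graphs are finite, undirected and simple. A graph is co-bipartite if its complement is bipartite; equivalently, its vertex set can be partitioned into two cliques. A graph is a circle graph if its vertices can be associated with chords of a circle so that two distinct vertices are adjacent if and only if the corresponding chords intersect. For a permutation $\pi$ of $\{1,\dots,n\}$, the permutation graph of $\pi$ has vertex set $\{1,\dots,n\}$, with $i<j$ adjacent if and only if $j$ occurs before $i$ in $\pi$; a graph is a permutation graph if it is isomorphic to the permutation graph of some permutation. *)

(* Defs.v *)
From mathcomp Require Import all_boot all_order all_algebra all_fingroup.
From mathcomp Require Import classical_sets reals.

Set Implicit Arguments.
Unset Strict Implicit.
Unset Printing Implicit Defensive.

Import Order.TTheory GRing.Theory Num.Theory.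

Record sgraph := SGraph {
  vertex :> finType;
  adj : rel vertex;
  adj_sym : symmetric adj;
  adj_irr : irreflexive adj }.

Definition isomorphic (G H : sgraph) : Prop :=
  exists2 f : G -> H, bijective f & forall u v : G, adj (f u) (f v) = adj u v.

Definition compl_adj (G : sgraph) : rel G :=
  fun u v => (u != v) && ~~ adj u v.

Lemma compl_adj_sym (G : sgraph) : symmetric (@compl_adj G).
Proof. by move=> u v; rewrite /compl_adj eq_sym adj_sym. Qed.

Lemma compl_adj_irr (G : sgraph) : irreflexive (@compl_adj G).
Proof. by move=> u; rewrite /compl_adj eqxx. Qed.

Definition compl (G : sgraph) : sgraph :=
  SGraph (@compl_adj_sym G) (@compl_adj_irr G).

Definition bipartite (G : sgraph) : Prop :=
  exists A : {set G}, forall u v : G, adj u v -> (u \in A) != (v \in A).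

Definition cobipartite (G : sgraph) : Prop := bipartite (compl G).

(* A permutation s is read as the word s 0, s 1, ..., s (n - 1), so the value
   j occurs in it at position s^-1 j. *)
Definition occurs_before n (s : 'S_n) (j i : 'I_n) : bool :=
  ((s^-1)%g j < (s^-1)%g i)%N.

Definition perm_adj n (s : 'S_n) : rel 'I_n := fun i j =>
  ((i < j)%N && occurs_before s j i) || ((j < i)%N && occurs_before s i j).

Lemma perm_adj_sym n (s : 'S_n) : symmetric (perm_adj s).
Proof. by move=> i j; rewrite /perm_adj orbC. Qed.

Lemma perm_adj_irr n (s : 'S_n) : irreflexive (perm_adj s).
Proof. by move=> i; rewrite /perm_adj ltnn. Qed.

Definition perm_graph n (s : 'S_n) : sgraph :=
  SGraph (perm_adj_sym s) (perm_adj_irr s).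

Definition permutation_graph (G : sgraph) : Prop :=
  exists n, exists s : 'S_n, isomorphic G (perm_graph s).

Local Open Scope classical_set_scope.
Local Open Scope ring_scope.

(* The norm that MathComp-Analysis puts on 'rV[R]_2 is the sup norm, hence the
   explicit Euclidean equation. *)
Definition circle (R : realType) (c : 'rV[R]_2) (r : R) : set 'rV[R]_2 :=
  [set p | (p 0 0 - c 0 0) ^+ 2 + (p 0 1 - c 0 1) ^+ 2 = r ^+ 2].

Definition segment (R : realType) (p q : 'rV[R]_2) : set 'rV[R]_2 :=
  [set x | exists2 t : R, 0 <= t <= 1 & x = (1 - t) *: p + t *: q].

Definition chord (R : realType) (c : 'rV[R]_2) (r : R) (K : set 'rV[R]_2)
    : Prop :=
  exists p q : 'rV[R]_2,
    [/\ circle c r p, circle c r q, p != q & K = segment p q].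

(* Chords are closed segments: two chords with a common endpoint intersect, and
   distinct vertices may be given the same chord. *)
Definition circle_graph (R : realType) (G : sgraph) : Prop :=
  exists (c : 'rV[R]_2) (r : R) (K : G -> set 'rV[R]_2),
    [/\ 0 < r,
        forall v : G, chord c r (K v)
      & forall u v : G, u != v -> (adj u v <-> K u `&` K v !=set0)].

(* Main.v *)
(* Only the implication from circle graphs to permutation graphs uses the two
   cliques. After perturbation, the 2n ends of the n chords are distinct points
   of the circle, numbered 0, ..., 2n - 1 along it. Chords of one clique cross
   pairwise, so an arc contains exactly one end of each of them as soon as it
   contains as many ends as the clique has chords. A window of n consecutive
   ends that contains the right number of ends of the first clique contains the
   right number for the second one too, and such a window exists by a discrete
   intermediate value argument. It therefore contains exactly one end of every
   chord, and two chords cross if and only if their ends inside the window and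
   their ends outside come in the same cyclic order: reading the outer ends
   backwards gives the permutation. *)
Require Import Defs.
From mathcomp Require Import all_boot all_order all_algebra all_fingroup.
From mathcomp Require Import classical_sets reals.
From mathcomp Require Import fintype finset zify ring lra.

Set Implicit Arguments.
Unset Strict Implicit.
Unset Printing Implicit Defensive.

Import Order.TTheory GRing.Theory Num.Theory.

(** * Linear orders and permutation graphs *)

(** The rank of [x] is the number of elements with a smaller key. *)
Lemma rank_bij d (K : orderType d) (T : finType) (k : T -> K) : injective k ->
  exists2 g : T -> 'I_#|T|, bijective g &
    forall x y, (g x < g y)%N = (k x < k y)%O.
Proof.
move=> k_inj; pose below x := [set y | (k y < k x)%O].
have below_lt x : (#|below x| < #|T|)%N.
  rewrite -cardsT; apply: proper_card; rewrite properE subsetT /=.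
  by apply/subsetPn; exists x; rewrite // inE ltxx.
pose g x := Ordinal (below_lt x).
have mono x y : (k x < k y)%O -> (g x < g y)%N.
  move=> xy; apply: proper_card; rewrite properE; apply/andP; split.
    by apply/subsetP => z; rewrite !inE => /lt_trans; apply.
  by apply/subsetPn; exists x; rewrite inE ?xy ?ltxx.
have ltE x y : (g x < g y)%N = (k x < k y)%O.
  have [/mono//|/mono lt|/k_inj ->] := ltgtP (k x) (k y); last by rewrite ltnn.
  by apply/negbTE; rewrite -leqNgt ltnW.
exists g => //; apply: inj_card_bij; last by rewrite card_ord.
move=> x y gxy; apply: k_inj; apply/eqP; rewrite eq_le !leNgt -!ltE gxy.
by rewrite ltnn.
Qed.

(** Ranks along [s] label the vertices, ranks along [t] are their positions in the word; inversions
    are the disagreements. *)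
Lemma permutation_graph_orders (G : sgraph) (s t : G -> nat) :
  injective s -> injective t ->
  (forall u v, u != v -> adj u v = ((s u < s v)%N != (t u < t v)%N)) ->
  permutation_graph G.
Proof.
move=> s_inj t_inj adjE.
have [f f_bij fE] := rank_bij s_inj; have [g g_bij gE] := rank_bij t_inj.
have [f' fK f'K] := f_bij; have [g' gK g'K] := g_bij.
have p_inj : injective (g \o f').
  by apply: inj_comp; [apply: can_inj gK | apply: can_inj f'K].
exists #|G|, (perm p_inj)^-1%g, f => // u v.
rewrite /= /perm_adj /occurs_before invgK !permE /= !fK !gE !fE !ltEnat /=.
have [->|nuv] := eqVneq u v; first by rewrite ltnn adj_irr.
have : s u != s v by apply: contra nuv => /eqP/s_inj/eqP.
have : t u != t v by apply: contra nuv => /eqP/t_inj/eqP.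
rewrite adjE //.
by case: (ltngtP (s u) (s v)) => //; case: (ltngtP (t u) (t v)).
Qed.

(** * Windows of consecutive chord ends *)

Definition cross (x y x' y' : nat) : bool :=
  [&& x < x', x' < y & y < y'] || [&& x' < x, x < y' & y' < y].

Section Window.
Variables (V : finType) (pos : V * bool -> nat).
Hypothesis pos_inj : injective pos.
Hypothesis pos_bound : forall e, pos e < #|V| + #|V|.
Local Notation n := #|V|.
Local Notation lo v := (pos (v, false)).
Local Notation hi v := (pos (v, true)).

Definition ends_below (A : {set V}) q :=
  \sum_(v in A) ((lo v < q) + (hi v < q)).

(** Counting end by end lets injectivity of [pos] bound the increments by one. *)
Lemma ends_belowE A q :
  ends_below A q = #|[set e | (e.1 \in A) && (pos e < q)]|.
Proof.
rewrite -sum1_card big_mkcond /=.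
pose F v b := if (v \in A) && (pos (v, b) < q) then 1 else 0.
rewrite (eq_bigr (fun e => F e.1 e.2)); last by move=> [v b] _; rewrite inE.
rewrite -(pair_bigA_idem _ F) //= /F.
rewrite /ends_below big_mkcond; apply: eq_bigr => v _.
by rewrite big_bool; case: (v \in A) => //=; rewrite addnC; do 2!case: (_ < q).
Qed.

Lemma ends_below_le A q m : q <= m -> ends_below A q <= ends_below A m.
Proof.
move=> qm; apply: leq_sum => v _; apply: leq_add;
  by case: ltnP => // /leq_trans -> //; apply: leq_b1.
Qed.

Lemma ends_belowS A q : ends_below A q.+1 <= (ends_below A q).+1.
Proof.
rewrite !ends_belowE.
have [/existsP[e0 /eqP e0q]|nex] := boolP [exists e, pos e == q].
  rewrite (cardsD1 e0) -[_.+1 in leqRHS]add1n leq_add ?leq_b1 //.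
  apply: subset_leq_card; apply/subsetP => e; rewrite !inE => /and3P[ne -> /=].
  by rewrite ltnS leq_eqVlt -e0q (inj_eq pos_inj) (negPf ne).
apply: leqW; apply: subset_leq_card; apply/subsetP => e.
rewrite !inE => /andP[-> /=]; rewrite ltnS leq_eqVlt => /orP[eq|//].
by case/negP: nex; apply/existsP; exists e.
Qed.

Lemma ends_belowD A q m : ends_below A (q + m) <= ends_below A q + m.
Proof.
elim: m => [|m IH]; first by rewrite !addn0.
by rewrite !addnS (leq_trans (ends_belowS _ _)).
Qed.

Lemma ends_below0 A : ends_below A 0 = 0.
Proof. by rewrite /ends_below big1. Qed.

Lemma ends_below_all A : ends_below A (n + n) = #|A| + #|A|.
Proof.
rewrite [RHS]addnn -muln2 -sum_nat_const /ends_below; apply: eq_bigr => v _.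
by rewrite !pos_bound.
Qed.

(** The count goes from 0 to [n + n] in [n + n] steps of at most one, so every step is exactly
    one. *)
Lemma ends_below_setT q : q <= n + n -> ends_below [set: V] q = q.
Proof.
move=> le_q; have := ends_belowD setT 0 q; have := ends_belowD setT q (n + n - q).
rewrite subnKC // ends_below_all add0n ends_below0 cardsT; lia.
Qed.

(* Discrete intermediate value theorem: the number of ends of [A] in the window
   [p, p + n) changes by at most one with [p], and the windows at [0] and [n]
   contain [2 #|A|] ends together. *)
Lemma balanced_window A :
  exists2 p, p <= n & ends_below A (p + n) = ends_below A p + #|A|.
Proof.
have all := ends_below_all A; have z := ends_below0 A.
have [le|gt] := leqP (ends_below A n) #|A|.
- have exP : exists p, ends_below A p + #|A| <= ends_below A (p + n).
    by exists n; rewrite all; lia.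
  (* At the least such start the preceding window still holds fewer than [#|A|] ends, so the unit
     step gives equality. *)
  case: (ex_minnP exP) => -[|p] leP minP.
    by exists 0 => //; move: leP; rewrite add0n z; lia.
  exists p.+1; first by apply: minP; rewrite all; lia.
  have := minP p; have := ends_belowS A (p + n).
  have := @ends_below_le A p p.+1 (leqnSn _); rewrite addSn in leP *; lia.
- have exP : exists p, ends_below A (p + n) <= ends_below A p + #|A|.
    by exists n; rewrite all; lia.
  case: (ex_minnP exP) => -[|p] leP minP.
    by exists 0 => //; move: leP; rewrite add0n z; lia.
  exists p.+1; first by apply: minP; rewrite all; lia.
  have := minP p; have := ends_belowS A p.
  have := @ends_below_le A (p + n) (p.+1 + n) (leqnSn _).
  rewrite addSn in leP *; lia.
Qed.

Definition ends_in p v := (p <= lo v < p + n) + (p <= hi v < p + n).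

Lemma ends_in_sum A p :
  ends_below A (p + n) = ends_below A p + \sum_(v in A) ends_in p v.
Proof.
have split_lt x : (x < p + n) = (x < p) + (p <= x < p + n) :> nat.
  by case: (ltnP x p) => //= xp; rewrite ltn_addr.
rewrite /ends_below -big_split; apply: eq_bigr => v _ /=.
by rewrite /ends_in !split_lt addnACA.
Qed.

Hypothesis lo_lt_hi : forall v, lo v < hi v.

(* If both ends of some chord of the clique lie in the window, then every chord
   crossing it has an end in the window; so the number of ends in the window is
   on the same side of [1] for all chords. *)
Lemma clique_window (A : {set V}) p :
  {in A &, forall u v, u != v -> cross (lo u) (hi u) (lo v) (hi v)} ->
  \sum_(v in A) ends_in p v = #|A| -> {in A, forall v, ends_in p v = 1}.
Proof.
move=> clique; rewrite -sum1_card => sumE.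
have [/existsP[v /andP[vA two]]|no2] := boolP [exists v in A, ends_in p v == 2].
- have ge1 u : u \in A -> 1 <= ends_in p u.
    move=> uA; have [->|uv] := eqVneq u v; first by rewrite (eqP two).
    move: (clique u v uA vA uv) two (lo_lt_hi u) (lo_lt_hi v).
    rewrite /cross /ends_in; do 4!case: (boolP (p <= _ < _)) => ? //=; lia.
  (* Equality of the sums forces equality in every termwise bound. *)
  have [_] := leqif_sum (fun u uA => leqif_eq (ge1 u uA)).
  rewrite sumE eqxx => /esym/forall_inP all1 u uA.
  by rewrite -(eqP (all1 u uA)).
- have le1 u : u \in A -> ends_in p u <= 1.
    move=> uA; have : ends_in p u != 2.
      by apply: contra no2 => two; apply/existsP; exists u; rewrite uA.
    by rewrite /ends_in; do 2!case: (_ && _).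
  have [_] := leqif_sum (fun u uA => leqif_eq (le1 u uA)).
  rewrite sumE eqxx => /esym/forall_inP all1 u uA.
  exact: (eqP (all1 u uA)).
Qed.

Lemma two_cliques_window (A : {set V}) :
  {in A &, forall u v, u != v -> cross (lo u) (hi u) (lo v) (hi v)} ->
  {in ~: A &, forall u v, u != v -> cross (lo u) (hi u) (lo v) (hi v)} ->
  exists2 p, p <= n & forall v, ends_in p v = 1.
Proof.
move=> cA cB; have [p p_le pE] := balanced_window A.
exists p => // v.
have sA : \sum_(v in A) ends_in p v = #|A|.
  by apply/eqP; rewrite -(eqn_add2l (ends_below A p)) -ends_in_sum pE.
have sB : \sum_(v in ~: A) ends_in p v = #|~: A|.
  have := ends_in_sum setT p; rewrite !ends_below_setT; try lia.
  rewrite (big_setID A) /= setTI setTD sA => /addnI.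
  by rewrite -(cardsC A) => /addnI.
have [vA|vA] := boolP (v \in A); first exact: (clique_window cA sA).
by apply: (clique_window cB sB); rewrite inE.
Qed.
End Window.

(** The window and its complement act as the two lines of a permutation diagram, each chord joining
    one to the other. *)
Lemma crossing_permutation_graph (G : sgraph) (pos : G * bool -> nat)
    (A : {set G}) :
  injective pos -> (forall e, pos e < #|G| + #|G|) ->
  (forall v, pos (v, false) < pos (v, true)) ->
  (forall u v, u != v -> adj u v =
     cross (pos (u, false)) (pos (u, true)) (pos (v, false)) (pos (v, true))) ->
  {in A &, forall u v : G, u != v -> adj u v} ->
  {in ~: A &, forall u v : G, u != v -> adj u v} ->
  permutation_graph G.
Proof.
move=> pos_inj pos_bound lohi adjE cA cB.
have [|| p p_le one] := @two_cliques_window _ pos pos_inj pos_bound lohi A.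
- by move=> u v uA vA uv; rewrite -adjE // cA.
- by move=> u v uA vA uv; rewrite -adjE // cB.
(* [top v] selects the end of [v] inside the window, [~~ top v] the one outside. *)
pose top v := ~~ (p <= pos (v, false) < p + #|G|).
(* [bot] reverses the cyclic order of the positions outside the window. *)
pose bot x := (if p + #|G| <= x then #|G| + #|G| else 0) + (#|G| + #|G|) - x.
have bot_inj e e' : ~~ (p <= pos e < p + #|G|) -> ~~ (p <= pos e' < p + #|G|) ->
    bot (pos e) = bot (pos e') -> e = e'.
  move=> ne ne' eb; apply: pos_inj; move: eb; rewrite /bot.
  by have := pos_bound e; have := pos_bound e'; do 2!case: ifP; lia.
have topP v : p <= pos (v, top v) < p + #|G| /\
              ~~ (p <= pos (v, ~~ top v) < p + #|G|).
  have := one v; rewrite /ends_in /top.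
  by case E : (p <= pos (v, false) < p + #|G|) => /=;
    case E' : (p <= pos (v, true) < _); rewrite ?E ?E'.
apply: (@permutation_graph_orders G (fun v => pos (v, top v))
          (fun v => bot (pos (v, ~~ top v)))).
- by move=> u v /pos_inj [].
- by move=> u v; case: (topP u) (topP v) => _ nu [_ nv] /(bot_inj _ _ nu nv) [].
move=> u v uv; rewrite adjE //.
have ne b b' : pos (u, b) != pos (v, b').
  by apply: contra uv => /eqP/pos_inj [->].
have := (ne false false, ne false true, ne true false, ne true true).
have := (lohi u, lohi v, topP u, topP v).
have := (pos_bound (u, false), pos_bound (u, true),
         pos_bound (v, false), pos_bound (v, true)).
have neqE (x y : bool) : (x != y) = (x && ~~ y) || (~~ x && y).
  by case: x y => [] [].
rewrite neqE /cross /bot; move: (top u) (top v) => [] [] /=;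
  move: (pos (u, false)) (pos (u, true)) (pos (v, false)) (pos (v, true));
  move=> a b c d [[[? ?] ?] ?] [[[? ?] [? ?]] [? ?]] [[[? ?] ?] ?];
  do 2!case: ifP => ?; lia.
Qed.

(** * Chords of a circle in stereographic coordinates *)

Section Geometry.
Local Open Scope ring_scope.
Local Open Scope classical_set_scope.
Variable R : realType.
Implicit Types (p q x : 'rV[R]_2) (a b t : R).

Lemma row2P p q : p 0 0 = q 0 0 -> p 0 1 = q 0 1 -> p = q.
Proof.
move=> e0 e1; apply/rowP => i.
by case: (unliftP ord0 i) => [j ->|->] //; rewrite (ord1 j) (_ : lift _ _ = 1) //;
  apply/val_inj.
Qed.

(** Twice the signed area of the triangle; its sign tells the side of the line [p q] on which [x]
    lies. *)
Definition area p q x : R :=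
  (q 0 0 - p 0 0) * (x 0 1 - p 0 1) - (q 0 1 - p 0 1) * (x 0 0 - p 0 0).

(** The area is affine in its last argument and vanishes at the common point, so [x] and [y] are not
    strictly on one side. *)
Lemma segment_meet_area p q x y :
  segment p q `&` segment x y !=set0 -> area p q x * area p q y <= 0.
Proof.
move=> [z [[s _ ->] [t /andP[t0 t1]]]] /[dup].
move=> /(congr1 (fun w : 'rV_2 => w 0 0)) + /(congr1 (fun w : 'rV_2 => w 0 1)).
rewrite !mxE => e0 e1; rewrite leNgt; apply/negP => gt0.
have e : (1 - t) * area p q x + t * area p q y = 0.
  have -> : (1 - t) * area p q x + t * area p q y =
     (q 0 0 - p 0 0) * ((1 - t) * x 0 1 + t * y 0 1 - p 0 1)
     - (q 0 1 - p 0 1) * ((1 - t) * x 0 0 + t * y 0 0 - p 0 0).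
    by rewrite /area; ring.
  by rewrite -e0 -e1; ring.
move: (area p q x) (area p q y) gt0 e => g h gt0 e.
have gg : 0 < g ^+ 2.
  by rewrite exprn_even_gt0 //=; apply: contraTneq gt0 => ->; rewrite mul0r ltxx.
have e' : (1 - t) * g ^+ 2 + t * (g * h) = 0.
  by rewrite -[RHS](mulr0 g) -e; ring.
by have [|] := leP t (1 / 2) => ht; nra.
Qed.

Lemma area_segment_meet p q x y :
  area p q x * area p q y < 0 -> area x y p * area x y q < 0 ->
  segment p q `&` segment x y !=set0.
Proof.
(* [g / (g - h)] is the zero of the affine function with value [g] at 0 and [h] at 1. *)
have ratio (g h : R) : g * h < 0 -> g - h != 0 /\ 0 <= g / (g - h) <= 1.
  move=> gh; have gh0 : g - h != 0.
    apply: contraTneq gh => /eqP; rewrite subr_eq0 => /eqP ->.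
    by rewrite -leNgt -expr2 sqr_ge0.
  split=> //; have [lt|gt|/eqP] := ltgtP 0 (g - h);
    last by rewrite eq_sym (negPf gh0).
  - by rewrite divr_ge0 ?ler_pdivrMr //; nra.
  - by rewrite -mulrNN -invrN divr_ge0 ?ler_pdivrMr //; nra.
move=> /ratio[n1 r1] /ratio[n2 r2].
exists ((1 - area x y p / (area x y p - area x y q)) *: p
         + (area x y p / (area x y p - area x y q)) *: q); split.
  by exists (area x y p / (area x y p - area x y q)).
exists (area p q x / (area p q x - area p q y)) => //.
by apply: row2P; rewrite !mxE; move: n1 n2; rewrite /area => n1 n2; field;
   apply/andP; split.
Qed.

Lemma segment_left p q : segment p q p.
Proof. by exists 0; rewrite ?lexx ?ler01 // subr0 scale1r scale0r addr0. Qed.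

Lemma segment_right p q : segment p q q.
Proof. by exists 1; rewrite ?lexx ?ler01 // subrr scale1r scale0r add0r. Qed.

Lemma segmentC p q : segment p q = segment q p.
Proof.
apply/seteqP; split=> _ [t /andP[t0 t1] ->]; exists (1 - t);
  by [rewrite subr_ge0 lerBlDr lerDl t0 t1 | rewrite subKr addrC].
Qed.

(* Stereographic parametrization, from the pole [c - u], of the circle with
   center [c] through [c + u]. *)
Definition circle_param (c u : 'rV[R]_2) (t : R) : 'rV[R]_2 :=
  \row_(i < 2) (c 0 i + (1 - t ^+ 2) / (1 + t ^+ 2) * u 0 i
    + 2 * t / (1 + t ^+ 2) * (if i == 0 then - u 0 1 else u 0 0)).

Lemma addr1_sqr_neq0 t : 1 + t ^+ 2 != 0.
Proof. by rewrite gt_eqF // ltr_wpDr ?sqr_ge0. Qed.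

Variables (c u : 'rV[R]_2) (r : R).
Hypotheses (r_gt0 : 0 < r) (u_norm : u 0 0 ^+ 2 + u 0 1 ^+ 2 = r ^+ 2).
Local Notation P := (circle_param c u).

Lemma circle_param_in t : circle c r (P t).
Proof.
rewrite /circle /= !mxE /= -u_norm.
have := addr1_sqr_neq0 t; by move=> ?; field.
Qed.

(** Up to a positive factor this is the Vandermonde product of [a], [b], [t]: only the order of the
    parameters decides the sign. *)
Lemma area_circle_param a b t : area (P a) (P b) (P t) =
  4 * r ^+ 2 * (b - a) * ((t - a) * (t - b))
   / ((1 + a ^+ 2) * (1 + b ^+ 2) * (1 + t ^+ 2)).
Proof.
rewrite /area !mxE /= -u_norm.
have := addr1_sqr_neq0 t; have := addr1_sqr_neq0 a; have := addr1_sqr_neq0 b.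
by move=> ???; field; apply/and3P; split.
Qed.

Lemma circle_param_inj : injective P.
Proof.
move=> a b eab; apply/eqP; rewrite -subr_eq0; apply/eqP.
(* A parameter beyond both [a] and [b] leaves [b - a] as the only factor that can vanish. *)
pose t := `|a| + `|b| + 1.
have lt_at : a < t by rewrite /t; have := ler_norm a; have := normr_ge0 b; lra.
have lt_bt : b < t by rewrite /t; have := ler_norm b; have := normr_ge0 a; lra.
have : area (P a) (P b) (P t) = 0 by rewrite /area eab; ring.
rewrite area_circle_param => /eqP; rewrite mulf_eq0 invr_eq0 !mulf_eq0.
rewrite !(negPf (addr1_sqr_neq0 _)) !orbF pnatr_eq0 /=.
rewrite (gt_eqF r_gt0) /= !subr_eq0 (gt_eqF lt_at) (gt_eqF lt_bt) !orbF.
by move=> /eqP ->; rewrite subrr.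
Qed.

Lemma area_circle_paramM a b s t : a != b -> exists2 k, 0 < k &
  area (P a) (P b) (P s) * area (P a) (P b) (P t) =
  k * ((s - a) * (s - b) * (t - a) * (t - b)).
Proof.
move=> ab; have pos z : 0 < 1 + z ^+ 2 :> R by rewrite ltr_wpDr ?sqr_ge0.
exists ((4 * r ^+ 2 * (b - a) / ((1 + a ^+ 2) * (1 + b ^+ 2))) ^+ 2
        / ((1 + s ^+ 2) * (1 + t ^+ 2))).
  apply: divr_gt0; last by rewrite mulr_gt0 ?pos.
  rewrite exprn_even_gt0 //=.
  apply: mulf_neq0; last by rewrite invr_eq0 mulf_neq0 ?addr1_sqr_neq0.
  by rewrite !mulf_neq0 ?pnatr_eq0 ?(gt_eqF r_gt0) // subr_eq0 eq_sym.
rewrite !area_circle_param.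
have := (addr1_sqr_neq0 t, addr1_sqr_neq0 a, addr1_sqr_neq0 b, addr1_sqr_neq0 s).
by move=> [[[? ?] ?] ?]; field; apply/and4P; split.
Qed.

Lemma circle_param_meet a b s t : a != b -> s != t ->
  segment (P a) (P b) `&` segment (P s) (P t) !=set0 <->
  (s - a) * (s - b) * (t - a) * (t - b) <= 0.
Proof.
move=> ab st; split.
  move=> /segment_meet_area; have [k k0 ->] := area_circle_paramM s t ab.
  by rewrite pmulr_rle0.
rewrite le_eqVlt => /orP[|lt0].
  rewrite !mulf_eq0 !subr_eq0 -!orbA => /or4P[] /eqP ->.
  - by exists (P a); split; [apply: segment_left | apply: segment_left].
  - by exists (P b); split; [apply: segment_right | apply: segment_left].
  - by exists (P a); split; [apply: segment_left | apply: segment_right].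
  - by exists (P b); split; [apply: segment_right | apply: segment_right].
(* The product is symmetric in the two chords, so each separates the ends of the other. *)
have [k k0 ek] := area_circle_paramM s t ab.
have [k' k'0 ek'] := area_circle_paramM a b st.
apply: area_segment_meet; rewrite ?ek ?ek' pmulr_rlt0 //.
by rewrite (_ : _ * _ = (s - a) * (s - b) * (t - a) * (t - b)) //; ring.
Qed.

Lemma circle_paramP p : circle c r p -> p != c - u -> exists t, p = P t.
Proof.
rewrite /circle /= => cp npole.
pose x := p 0 0 - c 0 0; pose y := p 0 1 - c 0 1.
(* Dot and cross product of [u] with [p - c]: [r ^+ 2] times the cosine and sine of the angle. The
   parameter will be [e / (r ^+ 2 + d)], the tangent of the half angle. *)
pose d := u 0 0 * x + u 0 1 * y; pose e := u 0 0 * y - u 0 1 * x.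
have cp' : x ^+ 2 + y ^+ 2 = r ^+ 2 by [].
have hd : d ^+ 2 + e ^+ 2 = r ^+ 2 * r ^+ 2.
  by rewrite -{1}u_norm -cp' /d /e; ring.
have r2 : r ^+ 2 != 0 by rewrite expf_neq0 ?gt_eqF.
have ex : x = (d * u 0 0 - e * u 0 1) / r ^+ 2.
  by apply: (mulIf r2); rewrite divfK // /d /e -u_norm; ring.
have ey : y = (d * u 0 1 + e * u 0 0) / r ^+ 2.
  by apply: (mulIf r2); rewrite divfK // /d /e -u_norm; ring.
(* This denominator vanishes only at the pole. *)
have rd : r ^+ 2 + d != 0.
  apply: contra npole; rewrite addrC addr_eq0 => /eqP dE.
  have e0 : e = 0.
    by apply/eqP; rewrite -sqrf_eq0; apply/eqP; move: hd; rewrite dE; lra.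
  apply/eqP/row2P; rewrite !mxE.
    by apply: (addIr (- c 0 0)); rewrite -/x ex dE e0; field; rewrite gt_eqF.
  by apply: (addIr (- c 0 1)); rewrite -/y ey dE e0; field; rewrite gt_eqF.
have E1 : (1 - (e / (r ^+ 2 + d)) ^+ 2) / (1 + (e / (r ^+ 2 + d)) ^+ 2)
   = d / r ^+ 2.
  have := addr1_sqr_neq0 (e / (r ^+ 2 + d)) => n.
  apply: (mulIf n); rewrite divfK //.
  apply: (mulIf r2); apply: (mulIf (expf_neq0 2 rd)).
  have -> : (1 - (e / (r ^+ 2 + d)) ^+ 2) * r ^+ 2 * (r ^+ 2 + d) ^+ 2
          = ((r ^+ 2 + d) ^+ 2 - e ^+ 2) * r ^+ 2 by field.
  have -> : d / r ^+ 2 * (1 + (e / (r ^+ 2 + d)) ^+ 2)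
            * r ^+ 2 * (r ^+ 2 + d) ^+ 2
          = d * ((r ^+ 2 + d) ^+ 2 + e ^+ 2) by field; rewrite rd gt_eqF.
  have -> : e ^+ 2 = r ^+ 2 * r ^+ 2 - d ^+ 2 by rewrite -hd; ring.
  ring.
have E2 : 2 * (e / (r ^+ 2 + d)) / (1 + (e / (r ^+ 2 + d)) ^+ 2)
   = e / r ^+ 2.
  have := addr1_sqr_neq0 (e / (r ^+ 2 + d)) => n.
  apply: (mulIf n); rewrite divfK //.
  apply: (mulIf r2); apply: (mulIf (expf_neq0 2 rd)).
  have -> : 2 * (e / (r ^+ 2 + d)) * r ^+ 2 * (r ^+ 2 + d) ^+ 2
          = 2 * e * (r ^+ 2 + d) * r ^+ 2 by field.
  have -> : e / r ^+ 2 * (1 + (e / (r ^+ 2 + d)) ^+ 2)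
            * r ^+ 2 * (r ^+ 2 + d) ^+ 2
          = e * ((r ^+ 2 + d) ^+ 2 + e ^+ 2) by field; rewrite rd gt_eqF.
  have -> : e ^+ 2 = r ^+ 2 * r ^+ 2 - d ^+ 2 by rewrite -hd; ring.
  ring.
exists (e / (r ^+ 2 + d)); apply: row2P; rewrite !mxE /= E1 E2.
  by apply: (addIr (- c 0 0)); rewrite -/x ex; field; rewrite gt_eqF.
by apply: (addIr (- c 0 1)); rewrite -/y ey; field; rewrite gt_eqF.
Qed.

End Geometry.

(** * From real parameters to distinct positions *)

(* Ties between ends are broken so that chords sharing an end cross: at a common
   point lower ends come first, then the order is that of the other ends, and
   finally that of a fixed enumeration of the chords. *)
Lemma distinct_ends (d : Order.disp_t) (K : orderType d) (V : finType)
    (l r : V -> K) :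
  (forall v, (l v < r v)%O) ->
  exists pos : V * bool -> nat,
  [/\ injective pos, forall e, pos e < #|V| + #|V|,
      forall v, pos (v, false) < pos (v, true)
    & forall u v, u != v ->
      cross (pos (u, false)) (pos (u, true)) (pos (v, false)) (pos (v, true))
      = ((l u <= l v <= r u) && (r u <= r v)
         || (l v <= l u <= r v) && (r v <= r u))%O].
Proof.
move=> lr.
pose key (e : V * bool) : K *l (bool *l (K *l 'I_#|V|)) :=
  if e.2 then (r e.1, (true, (l e.1, enum_rank e.1)))
  else (l e.1, (false, (r e.1, enum_rank e.1))).
have key_inj : injective key.
  by move=> [u []] [v []] //= [_ _ /enum_rank_inj ->].
have [g /bij_inj g_inj gE] := rank_bij key_inj.
have lo_lo u v : (g (u, false) < g (v, false)) =
    ((l u < l v) || (l u == l v) &&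
      ((r u < r v) || (r u == r v) && (enum_rank u < enum_rank v)%N))%O.
  rewrite gE /key /= !Order.ProdLexiOrder.ltEprodlexi /=.
  by case: (ltgtP (l u)) => //= _; case: (ltgtP (r u)).
have hi_hi u v : (g (u, true) < g (v, true)) =
    ((r u < r v) || (r u == r v) &&
      ((l u < l v) || (l u == l v) && (enum_rank u < enum_rank v)%N))%O.
  rewrite gE /key /= !Order.ProdLexiOrder.ltEprodlexi /=.
  by case: (ltgtP (r u)) => //= _; case: (ltgtP (l u)).
have lo_hi u v : (g (u, false) < g (v, true)) = (l u <= r v)%O.
  rewrite gE /key /= !Order.ProdLexiOrder.ltEprodlexi /=.
  by case: ltgtP.
exists (fun e => g e); split.
- by move=> e e' /val_inj/g_inj.
- move=> e; apply: leq_trans (ltn_ord _) _.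
  by rewrite card_prod card_bool muln2 addnn.
- by move=> v; rewrite lo_hi ltW.
move=> u v uv; rewrite /cross !lo_lo !hi_hi !lo_hi.
have : enum_rank u != enum_rank v by rewrite (inj_eq enum_rank_inj).
rewrite -val_eqE /=.
have := lr u; have := lr v.
case: (ltgtP (l u) (l v)) => [h1|h1|h1] /=;
  case: (ltgtP (r u) (r v)) => [h2|h2|h2] /=;
  rewrite ?andbF ?andbT ?orbF ?orbT //.
(* Only identical chords remain; the enumeration orders their lower and upper ends alike, so they
   cross. *)
rewrite h1 h2 => /ltW -> _.
by case: ltngtP.
Qed.

(** The product is nonpositive when one of [c], [d] lies in [[a, b]] and the other not strictly
    inside. *)
Lemma chord_order_cross (R : realType) (a b c d : R) :
  (a < b -> c < d -> ((c - a) * (c - b) * (d - a) * (d - b) <= 0) =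
  (a <= c <= b) && (b <= d) || (c <= a <= d) && (d <= b))%R.
Proof.
move=> ab cd.
have sgnM (x y : R) : ((x * y <= 0) = (x <= 0 <= y) || (y <= 0 <= x))%R.
  by have [|] := leP 0%R x; have [|] := leP 0%R y => hy hx; nra.
have inM x : ((x - a) * (x - b) <= 0)%R = (a <= x <= b)%R.
  by rewrite sgnM; case: (leP a x) => ax; case: (leP x b) => xb /=; lra.
have outM x : (0 <= (x - a) * (x - b))%R = (x <= a)%R || (b <= x)%R.
  rewrite -oppr_le0 -mulNr sgnM.
  by case: (leP x a) => ax; case: (leP b x) => xb /=; lra.
rewrite -mulrA sgnM !inM !outM.
case: (ltgtP a c) => ac; case: (ltgtP b d) => bd; case: (ltgtP a d) => ad;
  case: (ltgtP c b) => cb => //=; lra.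
Qed.

(** * The two implications *)

Local Open Scope ring_scope.
Local Open Scope classical_set_scope.

(** Provides a pole that is no chord end: natural parameters already give infinitely many points of
    the circle. *)
Lemma circle_avoid (R : realType) (c : 'rV[R]_2) (r : R) (s : seq 'rV[R]_2) :
  0 < r -> exists2 u : 'rV[R]_2,
    u 0 0 ^+ 2 + u 0 1 ^+ 2 = r ^+ 2 & c - u \notin s.
Proof.
move=> r_gt0; pose e : 'rV[R]_2 := \row_(i < 2) (if i == 0 then r else 0).
have e_norm : e 0 0 ^+ 2 + e 0 1 ^+ 2 = r ^+ 2.
  by rewrite !mxE /= expr0n addr0.
pose f (k : nat) := circle_param c e k%:R.
have f_inj : injective f.
  by move=> i j /(circle_param_inj r_gt0 e_norm)/eqP; rewrite eqr_nat => /eqP.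
have [/allP sub|/allPn[x /mapP[k _ ->] xs]] :=
  boolP (all [in s] (map f (iota 0 (size s).+1))).
  have := uniq_leq_size _ sub.
  by rewrite size_map size_iota ltnn map_inj_uniq ?iota_uniq // => /(_ isT).
exists (c - f k); last by rewrite subKr.
have := circle_param_in c e_norm k%:R; rewrite /circle /= -/(f k) !mxE => <-.
by rewrite -!(opprB (c 0 _)) !sqrrN.
Qed.

Lemma circle_graph_params (R : realType) (G : sgraph) : circle_graph R G ->
  exists a b : G -> R,
    [/\ forall v, a v < b v
      & forall u v, u != v -> (adj u v <->
        (a v - a u) * (a v - b u) * (b v - a u) * (b v - b u) <= 0)].
Proof.
move=> [c [r [K [r_gt0 chK adjK]]]].
have /fin_all_exists[f fP] v : exists pq : 'rV[R]_2 * 'rV[R]_2,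
    [/\ circle c r pq.1, circle c r pq.2, pq.1 != pq.2 & K v = segment pq.1 pq.2].
  by have [p [q ?]] := chK v; exists (p, q).
have [u u_norm] := circle_avoid c
  (map (fst \o f) (enum G) ++ map (snd \o f) (enum G)) r_gt0.
rewrite mem_cat negb_or => /andP[pole1 pole2].
have /fin_all_exists[ab abP] v : exists ab : R * R, ab.1 < ab.2 /\
    K v = segment (circle_param c u ab.1) (circle_param c u ab.2).
  have [c1 c2 neq ->] := fP v.
  have [|x ex] := circle_paramP r_gt0 u_norm c1.
    by apply: contra pole1 => /eqP <-; apply/mapP; exists v; rewrite ?mem_enum.
  have [|y ey] := circle_paramP r_gt0 u_norm c2.
    by apply: contra pole2 => /eqP <-; apply/mapP; exists v; rewrite ?mem_enum.
  have [xy|yx|xy] := ltgtP x y.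
  - by exists (x, y); rewrite ex ey.
  - by exists (y, x); rewrite ex ey segmentC.
  - by move: neq; rewrite ex ey xy eqxx.
exists (fun v => (ab v).1), (fun v => (ab v).2); split=> [v|v w vw].
  by have [] := abP v.
have [lt_v Kv] := abP v; have [lt_w Kw] := abP w.
rewrite adjK // Kv Kw.
by apply: (circle_param_meet c r_gt0 u_norm); rewrite lt_eqF.
Qed.

Lemma circle_graph_permutation (R : realType) (G : sgraph) :
  cobipartite G -> circle_graph R G -> permutation_graph G.
Proof.
move=> [A bipA] /circle_graph_params[a [b [ab adjE]]].
have [pos [pos_inj pos_bound lohi crossE]] := distinct_ends ab.
apply: (@crossing_permutation_graph G pos A) => //.
- move=> u v uv; rewrite crossE // -chord_order_cross //.
  by apply/idP/idP => /adjE; apply.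
- move=> u v uA vA uv; apply/negPn/negP => nadj.
  by have := bipA u v; rewrite /= /compl_adj uv nadj uA vA => /(_ isT).
- move=> u v; rewrite !inE => uA vA uv; apply/negPn/negP => nadj.
  have := bipA u v; rewrite /= /compl_adj uv nadj => /(_ isT).
  by rewrite (negPf uA) (negPf vA).
Qed.

Lemma permutation_graph_circle (R : realType) (G : sgraph) :
  permutation_graph G -> circle_graph R G.
Proof.
move=> [n [s [f f_bij adjf]]].
pose u : 'rV[R]_2 := \row_(i < 2) (if i == 0 then 1 else 0).
have u_norm : u 0 0 ^+ 2 + u 0 1 ^+ 2 = 1 ^+ 2.
  by rewrite !mxE /= expr0n addr0.
(* All [a] ends precede all [b] ends, so chords meet when both orders agree; the subtraction in [b]
   reverses word positions, turning inversions into crossings. *)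
pose a (i : 'I_n) : R := (i : nat)%:R.
pose b (i : 'I_n) : R := (n + n - (s^-1)%g i)%:R.
have ab i j : a i < b j.
  by rewrite ltr_nat; have := ltn_ord i; have := ltn_ord ((s^-1)%g j); lia.
exists 0, 1, (fun v => segment (circle_param 0 u (a (f v)))
                               (circle_param 0 u (b (f v)))).
split=> // [v|v w vw].
  exists (circle_param 0 u (a (f v))), (circle_param 0 u (b (f v))).
  split=> //; try exact: circle_param_in.
  by rewrite (inj_eq (circle_param_inj ltr01 u_norm)) lt_eqF.
rewrite (circle_param_meet 0 ltr01 u_norm) ?lt_eqF // -adjf.
have : f v != f w by rewrite (inj_eq (bij_inj f_bij)).
move: (f v) (f w) => {vw} i j ij.
rewrite chord_order_cross // !(ltW (ab _ _)) !andbT.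
rewrite /= /perm_adj /occurs_before /a /b !ler_nat.
have : (s^-1)%g i != (s^-1)%g j by rewrite (inj_eq perm_inj).
move: ij (ltn_ord ((s^-1)%g i)) (ltn_ord ((s^-1)%g j)); rewrite -!val_eqE /=.
move: (nat_of_ord i) (nat_of_ord j).
move: (nat_of_ord ((s^-1)%g i)) (nat_of_ord ((s^-1)%g j)).
move=> z t x y xy zn tn zt.
rewrite (_ : (_ || _) = ((x <= y) && (n + n - z <= n + n - t)
                      || (y <= x) && (n + n - t <= n + n - z))%N) //.
by lia.
Qed.

Theorem theorem8 (R : realType) (G : sgraph) (hG : cobipartite G) :
  circle_graph R G <-> permutation_graph G.
Proof.
split; first exact: circle_graph_permutation.
exact: permutation_graph_circle.
Qed.
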